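(* There is a 1-1 correspondence between skeletal $2$-term difference $A_\infty$-algebras and triplets $((A,d),(M,\Delta),(\mu,\chi))$ consisting of a difference algebra $(A,d)$, a bimodule $(M,\Delta)$ over it and a $3$-cocycle $(\mu,\chi)\in Z^3((A,d);(M,\Delta))$.
   Context: All vector spaces are over a field $\mathbf{k}$ of characteristic $0$. **Difference algebras and bimodules.** A difference algebra $(A,d)$ is an associative algebra $A$ with a linear map $d:A\to A$ satisfying $d(ab)=d(a)b+ad(b)+d(a)d(b)$ for $a,b\in A$. A bimodule over $(A,d)$ is a pair $(M,\Delta)$ of an $A$-bimodule $M$ and a linear map $\Delta:M\to M$ with $\Delta(au)=d(a)u+a\Delta(u)+d(a)\Delta(u)$ and $\Delta(ua)=\Delta(u)a+ud(a)+\Delta(u)d(a)$ for $a\in A,u\in M$. Let $M^d$ denote $M$ with the new $A$-bimodule structure given by the actions $(a,u)\mapsto(a+d(a))u$ and $(u,a)\mapsto u(a+d(a))$. **3-cocycles.** For $n\ge2$ let $C^n_{\mathrm{Diff}}((A,d);(M,\Delta))=\mathrm{Hom}(A^{\otimes n},M)\oplus\mathrm{Hom}(A^{\otimes(n-1)},M)$, with coboundary $$\delta_{\mathrm{Diff}}(f,\chi)=\big(\delta_{\mathrm{Hoch}}(f),\ \delta^d_{\mathrm{Hoch}}(\chi)+(-1)^n\partial^{d,\Delta}(f)\big),$$ where $\delta_{\mathrm{Hoch}}$ (resp. $\delta^d_{\mathrm{Hoch}}$) is the Hochschild coboundary operator of $A$ with coefficients in the $A$-bimodule $M$ (resp. $M^d$),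 that is, $(\delta_{\mathrm{Hoch}}f)(a_1,\ldots,a_{n+1})=a_1f(a_2,\ldots,a_{n+1})+\sum_{i=1}^n(-1)^if(\ldots,a_ia_{i+1},\ldots)+(-1)^{n+1}f(a_1,\ldots,a_n)a_{n+1}$ (and similarly for $M^d$ with its actions), and $$(\partial^{d,\Delta}f)(a_1,\ldots,a_n)=\sum_{p=1}^n\ \sum_{1\le i_1<\cdots<i_p\le n}f(a_1,\ldots,d(a_{i_1}),\ldots,d(a_{i_p}),\ldots,a_n)-\Delta(f(a_1,\ldots,a_n)).$$ $Z^3((A,d);(M,\Delta))$ is the space of $3$-cocycles of this complex, i.e. of $(\mu,\chi)\in C^3_{\mathrm{Diff}}((A,d);(M,\Delta))$ with $\delta_{\mathrm{Diff}}(\mu,\chi)=0$. **2-term difference $A_\infty$-algebras.** A $2$-term $A_\infty$-algebra $\mathfrak{a}=(A_1\xrightarrow{\delta}A_0,\odot,\mu)$ consists of a $2$-term complex $A_1\xrightarrow{\delta}A_0$ (a linear map of vector spaces), bilinear maps $\odot:A_i\times A_j\to A_{i+j}$ ($0\le i+j\le1$) and a trilinear map $\mu:A_0\times A_0\times A_0\to A_1$ such that for all $x,y,z,t\in A_0$, $h,k\in A_1$: (A1) $\delta(x\odot h)=x\odot\delta(h)$; (A2) $\delta(h\odot x)=\delta(h)\odot x$; (A3) $\delta(h)\odot k=h\odot\delta(k)$; (A4) $x\odot(y\odot z)-(x\odot y)\odot z=\delta(\mu(x,y,z))$; (A5) $x\odot(y\odot h)-(x\odot y)\odot h=\mu(x,y,\delta(h))$;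 (A6) $x\odot(h\odot y)-(x\odot h)\odot y=\mu(x,\delta(h),y)$; (A7) $h\odot(x\odot y)-(h\odot x)\odot y=\mu(\delta(h),x,y)$; (A8) $x\odot\mu(y,z,t)-\mu(x\odot y,z,t)+\mu(x,y\odot z,t)-\mu(x,y,z\odot t)+\mu(x,y,z)\odot t=0$. A difference operator on $\mathfrak{a}$ is a triple $\mathfrak{d}=(d_0,d_1,d_2)$ of linear maps $d_0:A_0\to A_0$, $d_1:A_1\to A_1$ with $d_0\circ\delta=\delta\circ d_1$ and a bilinear map $d_2:A_0\times A_0\to A_1$ such that for all $x,y,z\in A_0$, $h\in A_1$: (D1) $d_0(x)\odot y+x\odot d_0(y)+d_0(x)\odot d_0(y)-d_0(x\odot y)=\delta(d_2(x,y))$; (D2) $d_0(x)\odot h+x\odot d_1(h)+d_0(x)\odot d_1(h)-d_1(x\odot h)=d_2(x,\delta(h))$; (D3) $d_1(h)\odot x+h\odot d_0(x)+d_1(h)\odot d_0(x)-d_1(h\odot x)=d_2(\delta(h),x)$; (D4) $(x+d_0(x))\odot d_2(y,z)-d_2(x\odot y,z)+d_2(x,y\odot z)-d_2(x,y)\odot(z+d_0(z))=\mu(d_0(x),y,z)+\mu(x,d_0(y),z)+\mu(x,y,d_0(z))+\mu(d_0(x),d_0(y),z)+\mu(d_0(x),y,d_0(z))+\mu(x,d_0(y),d_0(z))+\mu(d_0(x),d_0(y),d_0(z))-d_1(\mu(x,y,z))$. The pair $(\mathfrak{a},\mathfrak{d})$ is a $2$-term difference $A_\infty$-algebra; it is *skeletal*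 if $\delta=0$. *)

(* Defs.v *)
From HB Require Import structures.
From mathcomp Require Import all_boot all_order all_algebra.

Set Implicit Arguments.
Unset Strict Implicit.
Unset Printing Implicit Defensive.

Import GRing.Theory.
Local Open Scope ring_scope.

(* Algebras are not assumed to be unital, so MathComp's [algType] does not
   apply; bimodules are likewise not assumed to be unital. *)
Record assoc_algebra (k : fieldType) := AssocAlgebra {
  alg_car :> lmodType k;
  alg_mul : {bilinear alg_car -> alg_car -> alg_car};
  alg_mulA : associative alg_mul
}.

Record bimodule (k : fieldType) (A : assoc_algebra k) := Bimodule {
  bim_car :> lmodType k;
  bim_l : {bilinear A -> bim_car -> bim_car};
  bim_r : {bilinear bim_car -> A -> bim_car};
  bim_lM : forall a b u, bim_l a (bim_l b u) = bim_l (alg_mul _ a b) u;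
  bim_lr : forall a u b, bim_l a (bim_r u b) = bim_r (bim_l a u) b;
  bim_rM : forall u a b, bim_r u (alg_mul _ a b) = bim_r (bim_r u a) b
}.

Record diff_algebra (k : fieldType) := DiffAlgebra {
  da_alg :> assoc_algebra k;
  da_d : {linear da_alg -> da_alg};
  da_dM : forall a b, da_d (alg_mul _ a b) =
    alg_mul _ (da_d a) b + alg_mul _ a (da_d b) + alg_mul _ (da_d a) (da_d b)
}.

Record diff_bimodule (k : fieldType) (A : diff_algebra k) := DiffBimodule {
  db_bim :> bimodule A;
  db_D : {linear db_bim -> db_bim};
  db_Dl : forall a u, db_D (bim_l _ a u) =
    bim_l _ (da_d A a) u + bim_l _ a (db_D u) + bim_l _ (da_d A a) (db_D u);
  db_Dr : forall u a, db_D (bim_r _ u a) =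
    bim_r _ (db_D u) a + bim_r _ u (da_d A a) + bim_r _ (db_D u) (da_d A a)
}.

(* The bimodule M^d. *)
Section TwistedBimodule.
Variables (k : fieldType) (A : diff_algebra k) (M : bimodule A).

Definition twist (a : A) : A := a + da_d A a.

Definition twist_l (a : A) (u : M) : M := bim_l M (twist a) u.
Definition twist_r (u : M) (a : A) : M := bim_r M u (twist a).

Lemma twist_is_linear : linear twist.
Proof. by move=> c a b; rewrite /twist linearP scalerDr addrACA. Qed.

Lemma twistM a b : twist (alg_mul A a b) = alg_mul A (twist a) (twist b).
Proof. by rewrite /twist da_dM linearDl !linearDr !addrA (addrAC _ _ (alg_mul A a _)). Qed.

Lemma twist_l_bilinear : bilinear_for *:%R *:%R twist_l.
Proof.
split=> [u|a] c x y; rewrite /twist_l; last exact: linearPr.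
by rewrite twist_is_linear linearPl.
Qed.

Lemma twist_r_bilinear : bilinear_for *:%R *:%R twist_r.
Proof.
split=> [a|u] c x y; rewrite /twist_r; first exact: linearPl.
by rewrite twist_is_linear linearPr.
Qed.

HB.instance Definition _ :=
  bilinear_isBilinear.Build k A M M *:%R *:%R twist_l twist_l_bilinear.
HB.instance Definition _ :=
  bilinear_isBilinear.Build k M A M *:%R *:%R twist_r twist_r_bilinear.

Lemma twist_lM a b u : twist_l a (twist_l b u) = twist_l (alg_mul A a b) u.
Proof. by rewrite /twist_l bim_lM twistM. Qed.

Lemma twist_lr a u b : twist_l a (twist_r u b) = twist_r (twist_l a u) b.
Proof. exact: bim_lr. Qed.

Lemma twist_rM u a b : twist_r u (alg_mul A a b) = twist_r (twist_r u a) b.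
Proof. by rewrite /twist_r twistM bim_rM. Qed.

Definition twisted_bimodule : bimodule A :=
  @Bimodule k A (bim_car M) twist_l twist_r twist_lM twist_lr twist_rM.

End TwistedBimodule.

(* Hom(A^{\otimes n}, M), as n-linear maps on n-tuples. *)
Definition multilinear (k : fieldType) (A M : lmodType k) (n : nat)
    (f : n.-tuple A -> M) : Prop :=
  forall (i : 'I_n) (a : n.-tuple A),
    linear (fun x : A => f [tuple if j == i then x else tnth a j | j < n]).

Record tensor_hom (k : fieldType) (A M : lmodType k) (n : nat) := TensorHom {
  th_fun :> n.-tuple A -> M;
  th_multilinear : multilinear th_fun
}.

(* Indices are 0-based: [tnth a i] is the argument a_{i+1}. *)
Section Coboundary.
Variables (k : fieldType) (A : assoc_algebra k).

Definition tuple_front n (a : n.+1.-tuple A) : n.-tuple A :=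
  [tuple tnth a (widen_ord (leqnSn n) j) | j < n].

Definition tuple_back n (a : n.+1.-tuple A) : n.-tuple A :=
  [tuple tnth a (lift ord0 j) | j < n].

Definition tuple_merge n (i : 'I_n) (a : n.+1.-tuple A) : n.-tuple A :=
  [tuple if (j < i)%N then tnth (tuple_front a) j
         else if j == i then alg_mul A (tnth (tuple_front a) j) (tnth (tuple_back a) j)
         else tnth (tuple_back a) j | j < n].

Definition delta_hoch (M : bimodule A) n (f : n.-tuple A -> M)
    (a : n.+1.-tuple A) : M :=
  bim_l M (tnth a ord0) (f (tuple_back a))
  + \sum_(i < n) (-1) ^+ i.+1 *: f (tuple_merge i a)
  + (-1) ^+ n.+1 *: bim_r M (f (tuple_front a)) (tnth a ord_max).

End Coboundary.

Section DifferenceComplex.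
Variables (k : fieldType) (A : diff_algebra k) (M : diff_bimodule A).

(* A choice 1 <= i_1 < ... < i_p <= n is a subset [I] of 'I_n of cardinal p. *)
Definition partial_diff n (f : n.-tuple A -> M) (a : n.-tuple A) : M :=
  (\sum_(1 <= p < n.+1) \sum_(I : {set 'I_n} | #|I| == p)
     f [tuple if i \in I then da_d A (tnth a i) else tnth a i | i < n])
  - db_D M (f a).

(* The coboundary in degree n.+2 (the complex has this form in degrees >= 2). *)
Definition delta_diff n (f : n.+2.-tuple A -> M) (chi : n.+1.-tuple A -> M) :
    (n.+3.-tuple A -> M) * (n.+2.-tuple A -> M) :=
  (delta_hoch f,
   fun a => delta_hoch (M := twisted_bimodule M) chi a
            + (-1) ^+ n.+2 *: partial_diff f a).

Record diff_cocycle n := DiffCocycle {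
  dc_f : tensor_hom A M n.+2;
  dc_chi : tensor_hom A M n.+1;
  dc_closed1 : forall a, (delta_diff dc_f dc_chi).1 a = 0;
  dc_closed2 : forall a, (delta_diff dc_f dc_chi).2 a = 0
}.

Definition Z3 := diff_cocycle 1.

End DifferenceComplex.

Record diff_triplet (k : fieldType) := DiffTriplet {
  dt_alg : diff_algebra k;
  dt_bim : diff_bimodule dt_alg;
  dt_cocycle : Z3 dt_bim
}.

Definition trilinear (k : fieldType) (U V W X : lmodType k)
    (f : U -> V -> W -> X) : Prop :=
  [/\ forall v w, linear (fun u => f u v w),
      forall u w, linear (fun v => f u v w)
    & forall u v, linear (f u v)].

(* [ai_m00], [ai_m01], [ai_m10] are the components of the product on
   A_0 x A_0, A_0 x A_1 and A_1 x A_0. *)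
Record Ainf2 (k : fieldType) := Ainf2_Build {
  ai_0 : lmodType k;
  ai_1 : lmodType k;
  ai_delta : {linear ai_1 -> ai_0};
  ai_m00 : {bilinear ai_0 -> ai_0 -> ai_0};
  ai_m01 : {bilinear ai_0 -> ai_1 -> ai_1};
  ai_m10 : {bilinear ai_1 -> ai_0 -> ai_1};
  ai_mu : ai_0 -> ai_0 -> ai_0 -> ai_1;
  ai_mu_trilinear : trilinear ai_mu;
  ai_A1 : forall x h, ai_delta (ai_m01 x h) = ai_m00 x (ai_delta h);
  ai_A2 : forall h x, ai_delta (ai_m10 h x) = ai_m00 (ai_delta h) x;
  ai_A3 : forall h l, ai_m01 (ai_delta h) l = ai_m10 h (ai_delta l);
  ai_A4 : forall x y z,
    ai_m00 x (ai_m00 y z) - ai_m00 (ai_m00 x y) z = ai_delta (ai_mu x y z);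
  ai_A5 : forall x y h,
    ai_m01 x (ai_m01 y h) - ai_m01 (ai_m00 x y) h = ai_mu x y (ai_delta h);
  ai_A6 : forall x h y,
    ai_m01 x (ai_m10 h y) - ai_m10 (ai_m01 x h) y = ai_mu x (ai_delta h) y;
  ai_A7 : forall h x y,
    ai_m10 h (ai_m00 x y) - ai_m10 (ai_m10 h x) y = ai_mu (ai_delta h) x y;
  ai_A8 : forall x y z t,
    ai_m01 x (ai_mu y z t) - ai_mu (ai_m00 x y) z t + ai_mu x (ai_m00 y z) t
    - ai_mu x y (ai_m00 z t) + ai_m10 (ai_mu x y z) t = 0
}.

Arguments ai_mu {k} a.

Record diff_operator (k : fieldType) (a : Ainf2 k) := DiffOperator {
  do_0 : {linear ai_0 a -> ai_0 a};
  do_1 : {linear ai_1 a -> ai_1 a};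
  do_2 : {bilinear ai_0 a -> ai_0 a -> ai_1 a};
  do_delta : forall h, do_0 (ai_delta a h) = ai_delta a (do_1 h);
  do_D1 : forall x y,
    ai_m00 a (do_0 x) y + ai_m00 a x (do_0 y) + ai_m00 a (do_0 x) (do_0 y)
    - do_0 (ai_m00 a x y) = ai_delta a (do_2 x y);
  do_D2 : forall x h,
    ai_m01 a (do_0 x) h + ai_m01 a x (do_1 h) + ai_m01 a (do_0 x) (do_1 h)
    - do_1 (ai_m01 a x h) = do_2 x (ai_delta a h);
  do_D3 : forall h x,
    ai_m10 a (do_1 h) x + ai_m10 a h (do_0 x) + ai_m10 a (do_1 h) (do_0 x)
    - do_1 (ai_m10 a h x) = do_2 (ai_delta a h) x;
  do_D4 : forall x y z,
    ai_m01 a (x + do_0 x) (do_2 y z) - do_2 (ai_m00 a x y) z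
    + do_2 x (ai_m00 a y z) - ai_m10 a (do_2 x y) (z + do_0 z)
    = ai_mu a (do_0 x) y z + ai_mu a x (do_0 y) z + ai_mu a x y (do_0 z)
      + ai_mu a (do_0 x) (do_0 y) z + ai_mu a (do_0 x) y (do_0 z)
      + ai_mu a x (do_0 y) (do_0 z) + ai_mu a (do_0 x) (do_0 y) (do_0 z)
      - do_1 (ai_mu a x y z)
}.

Record diff_Ainf2 (k : fieldType) := DiffAinf2 {
  dai_ainf :> Ainf2 k;
  dai_op : diff_operator dai_ainf
}.

Definition skeletal (k : fieldType) (S : diff_Ainf2 k) : Prop :=
  forall h, ai_delta S h = 0.

Definition skeletal_diff_Ainf2 (k : fieldType) := {S : diff_Ainf2 k | skeletal S}.

(* Common underlying data of the two kinds of objects, used to say that a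
   bijection between them keeps the spaces and all the structure maps, with
   A = A_0, M = A_1, d = d_0, Delta = d_1 and chi = d_2. *)
Record underlying_data (k : fieldType) := UnderlyingData {
  ud_0 : lmodType k;
  ud_1 : lmodType k;
  ud_m00 : ud_0 -> ud_0 -> ud_0;
  ud_m01 : ud_0 -> ud_1 -> ud_1;
  ud_m10 : ud_1 -> ud_0 -> ud_1;
  ud_mu : ud_0 -> ud_0 -> ud_0 -> ud_1;
  ud_d0 : ud_0 -> ud_0;
  ud_d1 : ud_1 -> ud_1;
  ud_d2 : ud_0 -> ud_0 -> ud_1
}.

Definition Ainf2_data (k : fieldType) (S : diff_Ainf2 k) : underlying_data k :=
  @UnderlyingData k (ai_0 S) (ai_1 S) (ai_m00 S) (ai_m01 S) (ai_m10 S) (ai_mu S)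
    (do_0 (dai_op S)) (do_1 (dai_op S)) (do_2 (dai_op S)).

Definition triplet_data (k : fieldType) (T : diff_triplet k) : underlying_data k :=
  let A := dt_alg T in let M := dt_bim T in let c := dt_cocycle T in
  @UnderlyingData k A M (alg_mul A) (bim_l M) (bim_r M)
    (fun x y z => dc_f c [tuple x; y; z])
    (da_d A) (db_D M)
    (fun x y => dc_chi c [tuple x; y]).

(* Main.v *)
From Stdlib Require Import FunctionalExtensionality ProofIrrelevance.
From HB Require Import structures.
Require Import Defs.
From mathcomp Require Import all_boot all_order all_algebra.
Import GRing.Theory.
Local Open Scope ring_scope.

(** When the differential vanishes, axioms (A1)-(A3) are trivial, and in
    (A4)-(A7) and (D1)-(D3) the right-hand sides vanish, because they contain
    the differential or evaluate a multilinear map at 0.  What is left of (A4)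
    is associativity on A_0, of (A5)-(A7) the bimodule axioms for A_1, of (D1)
    the rule for d_0 to be a difference operator, and of (D2)-(D3) its
    compatibility with d_1.  The last axioms (A8) and (D4) are the two
    components of the cocycle equation: the first reads off [delta_hoch3], and
    the second off [delta_hoch2] on the twisted bimodule and [partial_diff3],
    the sign (-1)^3 moving the difference term to the other side.  So the
    axioms of the two kinds of objects agree on the same structure maps.

    This yields maps in both directions which preserve the underlying data
    ([triplet_of_skeletal], [skeletal_of_triplet]).  They are mutually inverse
    as soon as an object of either kind is determined by its underlying data
    ([skeletal_data_inj], [triplet_data_inj]): a composite of the two maps
    fixes the data, hence the object.  On the A-infinity side the data forget
    the differential, which is recovered because it is 0; everything else that
    the data forget is a proof, or the value of a tensor map on a tuple not
    displayed as a list of its entries. *)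

(** * Extensionality *)

Arguments inj_pair2 {U P p x y} _.

Lemma linear_ext (k : fieldType) (U V : lmodType k) (f g : {linear U -> V}) :
  (f : U -> V) = g -> f = g.
Proof.
case: f g => [f [[f1] [f2]]] [g [[g1] [g2]]] /= e; rewrite e in f1 f2 *.
by rewrite (proof_irrelevance _ f1 g1) (proof_irrelevance _ f2 g2).
Qed.

Lemma bilinear_ext (k : fieldType) (U V W : lmodType k)
    (f g : {bilinear U -> V -> W}) :
  (f : U -> V -> W) = g -> f = g.
Proof.
case: f g => [f [[f1 f2 f3 f4]]] [g [[g1 g2 g3 g4]]] /= e.
rewrite e in f1 f2 f3 f4 *.
by rewrite (proof_irrelevance _ f1 g1) (proof_irrelevance _ f2 g2)
  (proof_irrelevance _ f3 g3) (proof_irrelevance _ f4 g4).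
Qed.

Lemma tensor_hom_ext (k : fieldType) (U V : lmodType k) n
    (f g : tensor_hom U V n) :
  (f : n.-tuple U -> V) = g -> f = g.
Proof.
case: f g => [f f1] [g g1] /= e; rewrite e in f1 *.
by rewrite (proof_irrelevance _ f1 g1).
Qed.

(* These ordinals are spelled out so that [tnth] at them computes on displayed
   tuples; this makes evaluations of tensor maps convertible to the curried
   maps they come from. *)
Local Notation "''0_ n" := (@Ordinal n 0 isT) (at level 8, n at level 2).
Local Notation "''1_ n" := (@Ordinal n 1 isT) (at level 8, n at level 2).
Local Notation "''2_ n" := (@Ordinal n 2 isT) (at level 8, n at level 2).

Ltac tuple_ext :=
  apply: eq_from_tnth => -[[|[|[|?]]] ?] //; rewrite ?tnth_mktuple ?inE //;
  by congr (tnth _ _); apply/val_inj.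

Lemma tuple2_eta {T : Type} (a : 2.-tuple T) :
  a = [tuple tnth a ''0_2; tnth a ''1_2].
Proof. tuple_ext. Qed.

Lemma tuple3_eta {T : Type} (a : 3.-tuple T) :
  a = [tuple tnth a ''0_3; tnth a ''1_3; tnth a ''2_3].
Proof. tuple_ext. Qed.

Lemma tuple4_eta {T : Type} (a : 4.-tuple T) :
  a = [tuple tnth a ''0_4; tnth a ''1_4; tnth a ''2_4; tnth a (@Ordinal 4 3 isT)].
Proof.
by apply: eq_from_tnth => -[[|[|[|[|?]]]] ?] //; congr (tnth _ _); apply/val_inj.
Qed.

(* Each identification can give further pairs of proofs the same type, as the
   statements of some fields mention proofs in earlier ones; hence the loop. *)
Ltac identify_proofs :=
  repeat match goal with
  | p : ?P, q : ?P |- _ => have ? := proof_irrelevance P p q; subst q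
  end.

(** * Objects are determined by their data *)

(** Skeletality is essential: the differential is not part of the data. *)
Lemma skeletal_data_inj (k : fieldType) (S1 S2 : skeletal_diff_Ainf2 k) :
  Ainf2_data (sval S1) = Ainf2_data (sval S2) -> S1 = S2.
Proof.
case: S1 => [[[A M dl m00 m01 m10 mu mu3 A1 A2 A3 A4 A5 A6 A7 A8]
  [d0 d1 d2 D0 D1 D2 D3 D4]] sk].
case: S2 => [[[A' M' dl' m00' m01' m10' mu' mu3' A1' A2' A3' A4' A5' A6' A7' A8']
  [d0' d1' d2' D0' D1' D2' D3' D4']] sk'].
rewrite /skeletal /Ainf2_data /= in d0 d1 d2 D0 D1 D2 D3 D4
  d0' d1' d2' D0' D1' D2' D3' D4' sk sk' * => e.
injection e => e2 e1 e0 emu e10 e01 e00 eM eA {e}.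
subst A'; subst M'.
move/inj_pair2/inj_pair2/bilinear_ext: e2 => e2.
move/inj_pair2/linear_ext: e1 => e1.
move/inj_pair2/linear_ext: e0 => e0.
move/inj_pair2/inj_pair2: emu => emu.
move/inj_pair2/inj_pair2/bilinear_ext: e10 => e10.
move/inj_pair2/inj_pair2/bilinear_ext: e01 => e01.
move/inj_pair2/bilinear_ext: e00 => e00.
have edl : dl = dl'.
  by apply/linear_ext/functional_extensionality => h; rewrite sk sk'.
subst m00' m01' m10' mu' d0' d1' d2' dl'.
by identify_proofs.
Qed.

(** The data only record a tensor map on tuples displayed by their entries,
    which every tuple is. *)
Lemma triplet_data_inj (k : fieldType) (T1 T2 : diff_triplet k) :
  triplet_data T1 = triplet_data T2 -> T1 = T2.
Proof.
case: T1 => [[[A m00 mA] d0 d0M] [[M m01 m10 lM lr rM] d1 d1l d1r] [f g c1 c2]].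
case: T2 => [[[A' m00' mA'] d0' d0M']
  [[M' m01' m10' lM' lr' rM'] d1' d1l' d1r'] [f' g' c1' c2']].
rewrite /triplet_data /= in d0 d0M m01 m10 lM lr rM d1 d1l d1r f g c1 c2
  d0' d0M' m01' m10' lM' lr' rM' d1' d1l' d1r' f' g' c1' c2' * => e.
injection e => eg e1 e0 ef e10 e01 e00 eM eA {e}.
subst A'; subst M'.
move/inj_pair2/inj_pair2: eg => eg.
have {}eg : g = g'.
  apply/tensor_hom_ext/functional_extensionality => a.
  by rewrite (tuple2_eta a); apply: (congr1 (fun h => h _ _) eg).
move/inj_pair2/linear_ext: e1 => e1.
move/inj_pair2/linear_ext: e0 => e0.
move/inj_pair2/inj_pair2: ef => ef.
have {}ef : f = f'.
  apply/tensor_hom_ext/functional_extensionality => a.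
  by rewrite (tuple3_eta a); apply: (congr1 (fun h => h _ _ _) ef).
move/inj_pair2/inj_pair2/bilinear_ext: e10 => e10.
move/inj_pair2/inj_pair2/bilinear_ext: e01 => e01.
move/inj_pair2/bilinear_ext: e00 => e00.
subst m00' m01' m10' d0' d1' f' g'.
by identify_proofs.
Qed.

(** * The cochain complex in low degree *)

Section LowDegree.
Variables (k : fieldType) (A : assoc_algebra k) (M : bimodule A).

Lemma delta_hoch2 (f : 2.-tuple A -> M) (x y z : A) :
  delta_hoch f [tuple x; y; z] =
  bim_l M x (f [tuple y; z]) - f [tuple alg_mul A x y; z]
  + f [tuple x; alg_mul A y z] - bim_r M (f [tuple x; y]) z.
Proof.
rewrite /delta_hoch !big_ord_recl big_ord0 /= !exprS expr0.
rewrite !(mulN1r, mulr1, opprK, scaleN1r, scale1r, addr0) !addrA.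
congr (_ + _ + _ - _).
- by congr (bim_l M _ (f _)); tuple_ext.
- by congr (- f _); tuple_ext.
- by congr (f _); tuple_ext.
- by congr (bim_r M (f _) _); tuple_ext.
Qed.

Lemma delta_hoch3 (f : 3.-tuple A -> M) (x y z t : A) :
  delta_hoch f [tuple x; y; z; t] =
  bim_l M x (f [tuple y; z; t]) - f [tuple alg_mul A x y; z; t]
  + f [tuple x; alg_mul A y z; t] - f [tuple x; y; alg_mul A z t]
  + bim_r M (f [tuple x; y; z]) t.
Proof.
rewrite /delta_hoch !big_ord_recl big_ord0 /= !exprS expr0.
rewrite !(mulN1r, mulr1, opprK, scaleN1r, scale1r, addr0) !addrA.
congr (_ + _ + _ + _ + _).
- by congr (bim_l M _ (f _)); tuple_ext.
- by congr (- f _); tuple_ext.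
- by congr (f _); tuple_ext.
- by congr (- f _); tuple_ext.
- by congr (bim_r M (f _) _); tuple_ext.
Qed.
End LowDegree.

(** The sum over p >= 1 of the p-element subsets runs once through every
    nonempty subset. *)
Lemma sum_set_by_card (V : nmodType) n (F : {set 'I_n} -> V) :
  \sum_(1 <= p < n.+1) \sum_(I : {set 'I_n} | #|I| == p) F I =
  \sum_(I : {set 'I_n} | I != set0) F I.
Proof.
rewrite (exchange_big_dep predT) //= [RHS]big_mkcond /=.
apply: eq_bigr => I _; under eq_bigl do rewrite eq_sym.
rewrite big_nat1_eq card_gt0 ltnS.
by rewrite -[X in (_ <= X)%N](card_ord n) max_card andbT.
Qed.

(** Subsets of a three-element set are triples of bits, over which a sum can be
    computed. *)
Lemma sum_set_ord3 (V : nmodType) (F : {set 'I_3} -> V) :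
  \sum_(I : {set 'I_3} | I != set0) F I =
  \sum_(b : bool * bool * bool | b != (false, false, false))
    F [set i : 'I_3 | nth false [:: b.1.1; b.1.2; b.2] i].
Proof.
rewrite (reindex (fun b : bool * bool * bool =>
  [set i : 'I_3 | nth false [:: b.1.1; b.1.2; b.2] i])) /=.
  apply: eq_bigl => -[[b0 b1] b2]; apply/set0Pn/idP => [[i]|].
    by rewrite inE; case: b0 b1 b2 i => [] [] [] [[|[|[|?]]] ?].
  by case: b0 b1 b2 => [] [] [] // _;
    [exists (inord 0)|exists (inord 0)|exists (inord 0)|exists (inord 0)
    |exists (inord 1)|exists (inord 1)|exists (inord 2)];
    rewrite inE inordK.
exists (fun I : {set 'I_3} => (inord 0 \in I, inord 1 \in I, inord 2 \in I)).
  by case=> [[? ?] ?] _; rewrite !inE !inordK.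
move=> I _; apply/setP => -[[|[|[|?]]] ?] //; rewrite inE /=;
  apply: (congr1 (fun i => i \in I)); apply/val_inj;
  by rewrite /= inordK.
Qed.

Section PartialDiff.
Variables (k : fieldType) (A : diff_algebra k) (M : diff_bimodule A).

Lemma partial_diff3 (f : 3.-tuple A -> M) (x y z : A) :
  partial_diff f [tuple x; y; z] =
  f [tuple da_d A x; y; z] + f [tuple x; da_d A y; z] + f [tuple x; y; da_d A z]
  + f [tuple da_d A x; da_d A y; z] + f [tuple da_d A x; y; da_d A z]
  + f [tuple x; da_d A y; da_d A z] + f [tuple da_d A x; da_d A y; da_d A z]
  - db_D M (f [tuple x; y; z]).
Proof.
rewrite /partial_diff sum_set_by_card sum_set_ord3; congr (_ - _).
have selectE (b : bool * bool * bool) :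
    [tuple if i \in [set i : 'I_3 | nth false [:: b.1.1; b.1.2; b.2] i]
           then da_d A (tnth [tuple x; y; z] i) else tnth [tuple x; y; z] i
     | i < 3] =
    [tuple if b.1.1 then da_d A x else x; if b.1.2 then da_d A y else y;
           if b.2 then da_d A z else z].
  by apply: eq_from_tnth => -[[|[|[|?]]] ?] //; rewrite tnth_mktuple inE.
under eq_bigr do rewrite selectE.
rewrite big_mkcond /= -(pair_bigA _ (fun b c => if (b, c) != (false, false, false)
   then f [tuple if b.1 then da_d A x else x; if b.2 then da_d A y else y;
           if c then da_d A z else z] else 0)) /=.
rewrite -(pair_bigA _ (fun a b => \sum_c if (a, b, c) != (false, false, false)
   then f [tuple if a then da_d A x else x; if b then da_d A y else y;
           if c then da_d A z else z] else 0)) /=.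
rewrite !big_bool /= addr0.
(* The bits run down from (true, true, true). *)
by rewrite !addrA [LHS](ACl (4*6*7*2*3*5*1)%AC).
Qed.
End PartialDiff.

(** * Tensor maps as curried multilinear maps *)

Section Multilinear.
Variables (k : fieldType) (A M : lmodType k).

Lemma multilinear_of_bilinear (f : A -> A -> M) :
  bilinear_for *:%R *:%R f ->
  multilinear (fun a : 2.-tuple A => f (tnth a ''0_2) (tnth a ''1_2)).
Proof.
case=> fl fr [[|[|//]] lt_i] a c x y; rewrite !tnth_mktuple /=.
- exact: fl.
- exact: fr.
Qed.

Lemma multilinear_of_trilinear (f : A -> A -> A -> M) :
  trilinear f ->
  multilinear (fun a : 3.-tuple A =>
    f (tnth a ''0_3) (tnth a ''1_3) (tnth a ''2_3)).
Proof.
case=> f1 f2 f3 [[|[|[|//]]] lt_i] a c x y; rewrite !tnth_mktuple /=.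
- exact: f1.
- exact: f2.
- exact: f3.
Qed.

Lemma tensor_hom_bilinear (f : tensor_hom A M 2) :
  bilinear_for *:%R *:%R (fun x y => f [tuple x; y]).
Proof.
split=> [y|x] c u v.
- have := th_multilinear f ''0_2 [tuple 0; y] c u v.
  have upd w : [tuple if j == ''0_2 then w else tnth [tuple 0; y] j | j < 2]
    = [tuple w; y] by tuple_ext.
  by rewrite !upd.
- have := th_multilinear f ''1_2 [tuple x; 0] c u v.
  have upd w : [tuple if j == ''1_2 then w else tnth [tuple x; 0] j | j < 2]
    = [tuple x; w] by tuple_ext.
  by rewrite !upd.
Qed.

Lemma tensor_hom_trilinear (f : tensor_hom A M 3) :
  trilinear (fun x y z => f [tuple x; y; z]).
Proof.
split=> [y z|x z|x y] c u v.
- have := th_multilinear f ''0_3 [tuple 0; y; z] c u v.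
  have upd w : [tuple if j == ''0_3 then w else tnth [tuple 0; y; z] j | j < 3]
    = [tuple w; y; z] by tuple_ext.
  by rewrite !upd.
- have := th_multilinear f ''1_3 [tuple x; 0; z] c u v.
  have upd w : [tuple if j == ''1_3 then w else tnth [tuple x; 0; z] j | j < 3]
    = [tuple x; w; z] by tuple_ext.
  by rewrite !upd.
- have := th_multilinear f ''2_3 [tuple x; y; 0] c u v.
  have upd w : [tuple if j == ''2_3 then w else tnth [tuple x; y; 0] j | j < 3]
    = [tuple x; y; w] by tuple_ext.
  by rewrite !upd.
Qed.
End Multilinear.

Lemma trilinear0 (k : fieldType) (U V W X : lmodType k)
    (f : U -> V -> W -> X) : trilinear f ->
  [/\ forall v w, f 0 v w = 0, forall u w, f u 0 w = 0
    & forall u v, f u v 0 = 0].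
Proof.
have lin0 (Y Z : lmodType k) (h : Y -> Z) : linear h -> h 0 = 0.
  by move/(_ (-1) 0 0); rewrite !scaleN1r !addNr.
by case=> f1 f2 f3; split=> *; [apply: lin0 (f1 _ _)|apply: lin0 (f2 _ _)
  |apply: lin0 (f3 _ _)].
Qed.

(** * The two constructions *)

(** Preservation of the data pins the triplet down, so the construction can
    stay hidden behind this specification. *)
Lemma triplet_of_skeletal (k : fieldType) (S : skeletal_diff_Ainf2 k) :
  {T : diff_triplet k | triplet_data T = Ainf2_data (sval S)}.
Proof.
case: S => [[[A M dl m00 m01 m10 mu mu3 A1 A2 A3 A4 A5 A6 A7 A8]
  [d0 d1 d2 D0 D1 D2 D3 D4]] sk].
rewrite /skeletal /Ainf2_data /= in d0 d1 d2 D0 D1 D2 D3 D4 sk *.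
have mA : associative m00.
  by move=> x y z; apply/subr0_eq; rewrite A4 sk.
have [mu00x mu0x0 mux00] := trilinear0 _ _ _ _ _ _ mu3.
have lM a b u : m01 a (m01 b u) = m01 (m00 a b) u.
  by apply/subr0_eq; rewrite A5 sk mux00.
have lr a u b : m01 a (m10 u b) = m10 (m01 a u) b.
  by apply/subr0_eq; rewrite A6 sk mu0x0.
have rM u a b : m10 u (m00 a b) = m10 (m10 u a) b.
  by apply/subr0_eq; rewrite A7 sk mu00x.
have dM a b : d0 (m00 a b) = m00 (d0 a) b + m00 a (d0 b) + m00 (d0 a) (d0 b).
  by apply/esym/subr0_eq; rewrite D1 sk.
have Dl a u : d1 (m01 a u) = m01 (d0 a) u + m01 a (d1 u) + m01 (d0 a) (d1 u).
  by apply/esym/subr0_eq; rewrite D2 sk linear0r.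
have Dr u a : d1 (m10 u a) = m10 (d1 u) a + m10 u (d0 a) + m10 (d1 u) (d0 a).
  by apply/esym/subr0_eq; rewrite D3 sk linear0l.
pose AA := @DiffAlgebra k (AssocAlgebra mA) d0 dM.
pose MM := @DiffBimodule k AA (@Bimodule k AA M m01 m10 lM lr rM) d1 Dl Dr.
pose f : tensor_hom AA MM 3 := TensorHom (multilinear_of_trilinear _ _ _ mu mu3).
have d2b : bilinear_for *:%R *:%R d2.
  by split=> [y|x]; [apply: linearPl|apply: linearPr].
pose g : tensor_hom AA MM 2 := TensorHom (multilinear_of_bilinear _ _ _ d2 d2b).
(* The two cocycle equations are (A8) and (D4). *)
have c1 a : (delta_diff f g).1 a = 0.
  by rewrite (tuple4_eta a) /delta_diff /= delta_hoch3; apply: A8.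
have c2 a : (delta_diff f g).2 a = 0.
  rewrite (tuple3_eta a) /delta_diff /= delta_hoch2 partial_diff3.
  rewrite -signr_odd /= expr1 scaleN1r; apply/eqP; rewrite subr_eq0; apply/eqP.
  exact: D4.
by exists (DiffTriplet (DiffCocycle c1 c2)).
Qed.

Lemma skeletal_of_triplet (k : fieldType) (T : diff_triplet k) :
  {S : skeletal_diff_Ainf2 k | Ainf2_data (sval S) = triplet_data T}.
Proof.
case: T => [A M [f g c1 c2]]; rewrite /triplet_data /=.
pose mu x y z := f [tuple x; y; z].
have mu3 : trilinear mu := tensor_hom_trilinear _ _ _ f.
have [mu00x mu0x0 mux00] := trilinear0 _ _ _ _ _ _ mu3.
pose g2 x y := g [tuple x; y].
pose g2b := bilinear_isBilinear.Build k A A M *:%R *:%R g2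
  (tensor_hom_bilinear _ _ _ g).
pose d2 : {bilinear A -> A -> M} := HB.pack g2 g2b.
have g2x0 x : g2 x 0 = 0 := linear0r d2 x.
have g20x x : g2 0 x = 0 := linear0l d2 x.
(* The differential is kept abstract so that simplification does not unfold
   it. *)
have [dl dl0] : {dl : {linear M -> A} | forall h, dl h = 0} by exists \0.
have A8 x y z t : bim_l M x (mu y z t) - mu (alg_mul A x y) z t
    + mu x (alg_mul A y z) t - mu x y (alg_mul A z t) + bim_r M (mu x y z) t = 0.
  by rewrite -delta_hoch3; apply: c1.
unshelve refine (let a := @Ainf2_Build k A M dl (alg_mul A) (bim_l M) (bim_r M)
  mu mu3 _ _ _ _ _ _ _ A8 in _) => /=.
- by move=> x h; rewrite !dl0 linear0r.
- by move=> h x; rewrite !dl0 linear0l.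
- by move=> h l; rewrite !dl0 linear0l linear0r.
- by move=> x y z; rewrite alg_mulA subrr dl0.
- by move=> x y h; rewrite bim_lM subrr dl0 mux00.
- by move=> x h y; rewrite bim_lr subrr dl0 mu0x0.
- by move=> h x y; rewrite bim_rM subrr dl0 mu00x.
unshelve refine (let o := @DiffOperator k a (da_d A) (db_D M) d2 _ _ _ _ _ in _) => /=.
- by move=> h; rewrite !dl0 linear0.
- by move=> x y; rewrite da_dM subrr dl0.
- by move=> x h; rewrite db_Dl subrr dl0 g2x0.
- by move=> h x; rewrite db_Dr subrr dl0 g20x.
- move=> x y z; apply/eqP; rewrite -subr_eq0; apply/eqP.
  have := c2 [tuple x; y; z].
  by rewrite /delta_diff /= delta_hoch2 partial_diff3 -signr_odd /= expr1 scaleN1r.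
by exists (exist (@skeletal k) (DiffAinf2 o) dl0).
Qed.

Theorem theorem5p1 (k : fieldType) (char_k : [pchar k] =i pred0) :
  exists F : skeletal_diff_Ainf2 k -> diff_triplet k,
    bijective F /\
    (forall S : skeletal_diff_Ainf2 k, triplet_data (F S) = Ainf2_data (sval S)).
Proof.
exists (fun S => sval (triplet_of_skeletal k S)).
split=> [|S]; last exact: (svalP (triplet_of_skeletal k S)).
exists (fun T => sval (skeletal_of_triplet k T)) => [S|T].
- apply: skeletal_data_inj.
  by rewrite (svalP (skeletal_of_triplet k _)) (svalP (triplet_of_skeletal k S)).
- apply: triplet_data_inj.
  by rewrite (svalP (triplet_of_skeletal k _)) (svalP (skeletal_of_triplet k T)).
Qed.
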